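(* Let $\mathfrak f$ and $\mathfrak a$ be finite-dimensional Lie algebras, with $\mathfrak a$ abelian. Let $B\in\mathrm{Sym}^2(\mathfrak f,\mathfrak a)^{\mathrm{ad}}$, and let $s$ be a section of the associated crossed module $\mathfrak G_B$. Then the formula $$\eta_{B,s}(f,g):=\Bigl([f,g]-s\bigl([f(1),g(1)]\bigr),\ \tilde\eta_B(f,g)\Bigr),\qquad f,g\in P_0\mathfrak f,$$ defines an infinitesimal adjustment on $\mathfrak G_B$ adapted to the section $s$ such that $\mathrm{KL}^{\mathrm{adj}}(\mathfrak G_B,\eta_{B,s})=B$.
   Context: $\mathrm{Sym}^2(\mathfrak f,\mathfrak a)^{\mathrm{ad}}$ is the space of symmetric bilinear $B:\mathfrak f\times\mathfrak f\to\mathfrak a$ with $B([X,Y],Z)=B(X,[Y,Z])$. $P_0\mathfrak f$ is the Fréchet Lie algebra of smooth paths $f:[0,1]\to\mathfrak f$ with $f(0)=0$, with pointwise bracket, and $L_0\mathfrak f\subset P_0\mathfrak f$ the subalgebra of those with $f(1)=0$. Put $\tilde\eta_B(f,g)=-2\int_0^1B(f'(t),g(t))\,dt$ for $f,g\in P_0\mathfrak f$. Let $\widetilde{L_0\mathfrak f}=L_0\mathfrak f\oplus\mathfrak a$ with bracket $[(f,a),(g,b)]=([f,g],\tilde\eta_B(f,g))$. Then $\mathfrak G_B=(\widetilde{L_0\mathfrak f}\xrightarrow{t}P_0\mathfrak f\xrightarrow{\alpha}\mathfrak{der}(\widetilde{L_0\mathfrak f}))$ is the central crossed module of Lie algebras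 with $t(f,a)=f$ and $\alpha(f,(g,b))=([f,g],\tilde\eta_B(f,g))$; it has $\pi_1(\mathfrak G_B)=\ker t=\mathfrak a$ and $\pi_0(\mathfrak G_B)=P_0\mathfrak f/L_0\mathfrak f=\mathfrak f$ via $p=\mathrm{ev}_1$. A section of $\mathfrak G_B$ is a linear map $s:\mathfrak f\to P_0\mathfrak f$ with $s(x)(1)=x$. For a crossed module of Lie algebras $(\mathfrak h\xrightarrow{t}\mathfrak g\xrightarrow{\alpha}\mathfrak{der}(\mathfrak h))$ with projection $p:\mathfrak g\to\mathfrak g/t(\mathfrak h)$, an infinitesimal adjustment is a continuous bilinear $\eta:\mathfrak g\times\mathfrak g\to\mathfrak h$ with $\eta([X,Y],Z)+\eta(Y,[X,Z])=\eta(X,[Y,Z])$, $\eta(tx,Y)=-\alpha(Y,x)$, $\eta(X,ty)=\alpha(X,y)$; it is adapted to a section $s$ if $t\eta(X,Y)=\rho_s([X,Y])$, $\rho_s=\mathrm{id}-sp$. For an adapted $\eta$, $\mathrm{KL}^{\mathrm{adj}}(\mathfrak G,\eta)$ is the unique $B\in\mathrm{Sym}^2(\mathfrak g/t(\mathfrak h),\ker t)^{\mathrm{ad}}$ with $\frac12(\eta(X,Y)+\eta(Y,X))=-B(pX,pY)$. *)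

(* Defs.v *)
From HB Require Import structures.
From mathcomp Require Import all_boot all_order all_algebra.
From mathcomp Require Import all_classical all_reals all_analysis.

Set Implicit Arguments.
Unset Strict Implicit.
Unset Printing Implicit Defensive.

Import Order.TTheory GRing.Theory Num.Theory.
Import numFieldNormedType.Exports.

Local Open Scope classical_set_scope.
Local Open Scope ring_scope.

HB.mixin Record Lmodule_isLieAlgebra (R : realType) L & GRing.Lmodule R L := {
  lie : L -> L -> L;
  lie_linearl : forall y : L, linear (fun x => lie x y);
  lie_linearr : forall x : L, linear (lie x);
  liexx : forall x : L, lie x x = 0;
  lie_jacobi : forall x y z : L,
    lie x (lie y z) + lie y (lie z x) + lie z (lie x y) = 0
}.

#[short(type="lieAlgType")]
HB.structure Definition LieAlgebra (R : realType) :=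
  {L of GRing.Lmodule R L & Lmodule_isLieAlgebra R L}.

#[short(type="finLieAlgType")]
HB.structure Definition FinLieAlgebra (R : realType) :=
  {L of LieAlgebra R L & Vector R L}.

(* No compatibility of the topology with the operations is required. *)
#[short(type="preTopLieAlgType")]
HB.structure Definition PreTopLieAlgebra (R : realType) :=
  {L of LieAlgebra R L & Topological L}.

Notation "[ 'lie' x , y ]" := (lie x y)
  (at level 0, format "[ 'lie'  x ,  y ]") : ring_scope.

Section LieTheory.
Variables (R : realType) (L : lieAlgType R).
Implicit Types x y z : L.

Lemma lieDl x y z : [lie x + y, z] = [lie x, z] + [lie y, z].
Proof. by have := lie_linearl z 1 x y; rewrite !scale1r. Qed.
Lemma lieDr x y z : [lie z, x + y] = [lie z, x] + [lie z, y].
Proof. by have := lie_linearr z 1 x y; rewrite !scale1r. Qed.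
Lemma lie0l x : [lie 0, x] = 0.
Proof. by apply: (@addrI _ [lie 0, x]); rewrite -lieDl !addr0. Qed.
Lemma lie0r x : [lie x, 0] = 0.
Proof. by apply: (@addrI _ [lie x, 0]); rewrite -lieDr !addr0. Qed.
Lemma lieZl c x y : [lie c *: x, y] = c *: [lie x, y].
Proof. by have := lie_linearl y c x 0; rewrite lie0l !addr0. Qed.
Lemma lieZr c x y : [lie x, c *: y] = c *: [lie x, y].
Proof. by have := lie_linearr x c y 0; rewrite lie0r !addr0. Qed.
Lemma lieNC x y : [lie x, y] = - [lie y, x].
Proof.
apply/eqP; rewrite -addr_eq0; have := liexx (x + y).
by rewrite lieDl !lieDr !liexx add0r addr0 => ->.
Qed.
Lemma lieNl x y : [lie - x, y] = - [lie x, y].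
Proof. by rewrite -scaleN1r lieZl scaleN1r. Qed.
Lemma lieNr x y : [lie x, - y] = - [lie x, y].
Proof. by rewrite -scaleN1r lieZr scaleN1r. Qed.
Lemma lie_leibniz x y z :
  [lie x, [lie y, z]] = [lie [lie x, y], z] + [lie y, [lie x, z]].
Proof.
have := lie_jacobi x y z; rewrite -addrA => /eqP; rewrite addr_eq0 => /eqP->.
by rewrite opprD addrC (lieNC z) opprK (lieNC z x) lieNr opprK.
Qed.
End LieTheory.

Definition lie_abelian (R : realType) (L : lieAlgType R) : Prop :=
  forall x y : L, [lie x, y] = 0.

Definition lie_morphism (R : realType) (K L : lieAlgType R) (phi : K -> L) :
  Prop := forall x y, phi [lie x, y] = [lie phi x, phi y].

Record sym2_ad (R : realType) (f : lieAlgType R) (a : lmodType R) := Sym2Ad {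
  sym2_fun :> f -> f -> a;
  sym2_linearl : forall Y, linear (fun X => sym2_fun X Y);
  sym2_linearr : forall X, linear (sym2_fun X);
  sym2_sym : forall X Y, sym2_fun X Y = sym2_fun Y X;
  sym2_ad_inv : forall X Y Z, sym2_fun [lie X, Y] Z = sym2_fun X [lie Y, Z]
}.

(* The map alpha : g -> der(h) is given in uncurried form.                    *)
Record lie_crossed_module (R : realType) (h g : lieAlgType R) :=
  LieCrossedModule {
  cm_t : {linear h -> g};
  cm_t_lie : lie_morphism cm_t;
  cm_alpha : g -> h -> h;
  cm_alpha_linearl : forall x, linear (fun X => cm_alpha X x);
  cm_alpha_linearr : forall X, linear (cm_alpha X);
  cm_alpha_der : forall X x y,
    cm_alpha X [lie x, y] = [lie cm_alpha X x, y] + [lie x, cm_alpha X y];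
  cm_alpha_lie : forall X Y x,
    cm_alpha [lie X, Y] x =
      cm_alpha X (cm_alpha Y x) - cm_alpha Y (cm_alpha X x);
  cm_equivariant : forall X x, cm_t (cm_alpha X x) = [lie X, cm_t x];
  cm_peiffer : forall x y, cm_alpha (cm_t x) y = [lie x, y]
}.

(* An exact sequence 0 -> k -> h -t-> g -> q -> 0 of Lie algebras, which      *)
(* identifies k with ker t (= pi_1) and q with g / t(h) (= pi_0).             *)
Record cm_homotopy (R : realType) (h g : lieAlgType R)
    (G : lie_crossed_module h g) (q k : lieAlgType R) := CMHomotopy {
  cm_p : {linear g -> q};
  cm_p_lie : lie_morphism cm_p;
  cm_p_surj : forall x, exists X, cm_p X = x;
  cm_p_ker : forall X, cm_p X = 0 <-> exists x, X = cm_t G x;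
  cm_i : {linear k -> h};
  cm_i_lie : lie_morphism cm_i;
  cm_i_inj : injective cm_i;
  cm_i_im : forall x, cm_t G x = 0 <-> exists u, x = cm_i u
}.

Record cm_section (R : realType) (h g : lieAlgType R)
    (G : lie_crossed_module h g) (q k : lieAlgType R) (H : cm_homotopy G q k) :=
  CMSection {
  section_fun :> {linear q -> g};
  section_funK : forall x, cm_p H (section_fun x) = x
}.

Record is_infinitesimal_adjustment (R : realType) (h g : preTopLieAlgType R)
    (G : lie_crossed_module h g) (eta : g -> g -> h) : Prop :=
  IsInfinitesimalAdjustment {
  adj_linearl : forall Y, linear (fun X => eta X Y);
  adj_linearr : forall X, linear (eta X);
  adj_continuous : continuous (fun XY : g * g => eta XY.1 XY.2);
  adj_cocycle : forall X Y Z,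
    eta [lie X, Y] Z + eta Y [lie X, Z] = eta X [lie Y, Z];
  adj_tl : forall x Y, eta (cm_t G x) Y = - cm_alpha G Y x;
  adj_tr : forall X y, eta X (cm_t G y) = cm_alpha G X y
}.

Section Adapted.
Variables (R : realType) (h g : lieAlgType R) (G : lie_crossed_module h g).
Variables (q k : lieAlgType R) (H : cm_homotopy G q k).

Definition section_rho (s : cm_section H) (X : g) : g := X - s (cm_p H X).

Definition is_adapted (s : cm_section H) (eta : g -> g -> h) : Prop :=
  forall X Y, cm_t G (eta X Y) = section_rho s [lie X, Y].

Definition is_KLadj (eta : g -> g -> h) (B : sym2_ad q k) : Prop :=
  unique (fun B' : sym2_ad q k => forall X Y,
    2^-1 *: (eta X Y + eta Y X) = - cm_i H (B' (cm_p H X) (cm_p H Y))) B.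

End Adapted.

Section SmoothOnUnitInterval.
Variable R : realType.
Implicit Types (f g : R -> R) (t : R).

Definition dquot01 f (t u : R) : R := (u - t)^-1 * (f u - f t).

(* Two-sided at interior points and one-sided at 0 and 1. *)
Definition derivable01 f : Prop :=
  forall t, t \in `[0, 1] -> cvg (dquot01 f t u @[u --> within `[0, 1] t^']).

Definition deriv01 f (t : R) : R :=
  if t \in `[0, 1] then lim (dquot01 f t u @[u --> within `[0, 1] t^']) else 0.

Definition smooth01 f : Prop :=
  forall n, derivable01 (iter n deriv01 f).

Let I01 : set R := [set` `[0, 1]].

Lemma within01_proper t : t \in `[0, 1] -> ProperFilter (within I01 t^').
Proof.
move=> tI; split; last exact: within_filter.
rewrite /within/= /dnbhs /within/= /prop_near1/= => /nbhs_ballP[e /= e0].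
move: tI; rewrite in_itv/= => /andP[t0 t1].
case: (ltP t 1) => [tlt1|tge1].
- pose u := Num.min (t + e / 2) 1.
  have tu : t < u by rewrite /u lt_min tlt1 ltrDl divr_gt0.
  have u1 : u <= 1 by rewrite /u ge_min lexx orbT.
  have ut : u - t < e.
    rewrite ltrBlDl gt_min; apply/orP; left.
    by rewrite ltrD2l ltr_pdivrMr// ltr_pMr// ltr1n.
  move=> /(_ u); rewrite /ball/= /I01/= in_itv/= u1 (le_trans t0) ?ltW//.
  apply=> //; last by rewrite gt_eqF.
  by rewrite distrC ger0_norm// subr_ge0 ltW.
- pose u := Num.max (t - e / 2) 0.
  have ut : u < t.
    by rewrite /u gt_max (lt_le_trans ltr01)// gtrBl divr_gt0.
  have u0 : 0 <= u by rewrite /u le_max lexx orbT.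
  have tu : t - u < e.
    rewrite ltrBlDr -ltrBlDl lt_max; apply/orP; left.
    by rewrite ltrD2l ltrN2 ltr_pdivrMr// ltr_pMr// ltr1n.
  move=> /(_ u); rewrite /ball/= /I01/= in_itv/= u0 (le_trans _ t1) ?ltW//.
  apply=> //; last by rewrite lt_eqF.
  by rewrite ger0_norm// subr_ge0 ltW.
Qed.

Definition is_deriv01 f t (l : R) : Prop := dquot01 f t u @[u --> within I01 t^'] --> l.

Lemma is_deriv01_eq f t l : t \in `[0, 1] -> is_deriv01 f t l -> deriv01 f t = l.
Proof.
move=> tI fl; rewrite /deriv01 tI; have PF := within01_proper tI.
exact: (cvg_lim _ fl).
Qed.

Lemma derivable01P f t : derivable01 f -> t \in `[0, 1] ->
  is_deriv01 f t (deriv01 f t).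
Proof. by move=> df tI; rewrite /deriv01 tI; exact: df. Qed.

Lemma deriv01_out f t : t \notin `[0, 1] -> deriv01 f t = 0.
Proof. by rewrite /deriv01 => /negbTE->. Qed.

Lemma dquot01K f t u : f u = f t + (u - t) * dquot01 f t u.
Proof.
have [->|ut] := eqVneq u t; first by rewrite subrr mul0r addr0.
by rewrite /dquot01 mulVKf ?subr_eq0// addrC subrK.
Qed.

Lemma is_deriv01_cont f t l : is_deriv01 f t l ->
  f u @[u --> within I01 t^'] --> f t.
Proof.
move=> fl; rewrite [X in X @ _](_ : _ = fun u => f t + (u - t) * dquot01 f t u);
  last by apply/funext => u; exact: dquot01K.
rewrite -[X in _ --> X]addr0 -[X in _ --> _ + X](mul0r l).
apply: cvgD; first exact: cvg_cst.
apply: cvgM => //; rewrite -[X in _ --> X](subrr t).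
apply: cvgB; last exact: cvg_cst.
by apply: cvg_within_filter; apply: cvg_within_filter; exact: cvg_id.
Qed.

Lemma is_deriv01_cst c t : is_deriv01 (fun=> c) t 0.
Proof.
rewrite /is_deriv01 /dquot01 subrr; under eq_fun do rewrite mulr0.
exact: cvg_cst.
Qed.

Lemma is_deriv01D f g t l m : is_deriv01 f t l -> is_deriv01 g t m ->
  is_deriv01 (fun u => f u + g u) t (l + m).
Proof.
move=> fl gm; rewrite /is_deriv01.
rewrite [X in X @ _](_ : _ = fun u => dquot01 f t u + dquot01 g t u).
  exact: cvgD.
by apply/funext => u; rewrite /dquot01 -mulrDr opprD addrACA.
Qed.

Lemma is_deriv01M f g t l m : is_deriv01 f t l -> is_deriv01 g t m ->
  is_deriv01 (fun u => f u * g u) t (l * g t + f t * m).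
Proof.
move=> fl gm; rewrite /is_deriv01.
rewrite [X in X @ _](_ : _ =
    fun u => dquot01 f t u * g u + f t * dquot01 g t u).
  apply: cvgD; apply: cvgM => //; last exact: cvg_cst.
  exact: is_deriv01_cont gm.
apply/funext => u; rewrite /dquot01 -mulrA [f t * (_ * _)]mulrCA -mulrDr; congr (_ * _).
by rewrite mulrBl mulrBr addrA subrK.
Qed.

Lemma deriv01_cst c : deriv01 (fun=> c) = fun=> 0.
Proof.
apply/funext => t; have [tI|/deriv01_out//] := boolP (t \in `[0, 1]).
exact/is_deriv01_eq/is_deriv01_cst.
Qed.

Lemma derivable01_cst c : derivable01 (fun=> c).
Proof. by move=> t _; apply/cvg_ex; exists 0; exact: is_deriv01_cst. Qed.

Lemma derivable01D f g : derivable01 f -> derivable01 g ->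
  derivable01 (fun u => f u + g u).
Proof.
move=> df dg t tI; apply/cvg_ex; eexists.
by apply: is_deriv01D; apply: derivable01P tI.
Qed.

Lemma derivable01M f g : derivable01 f -> derivable01 g ->
  derivable01 (fun u => f u * g u).
Proof.
move=> df dg t tI; apply/cvg_ex; eexists.
by apply: is_deriv01M; apply: derivable01P tI.
Qed.

Lemma deriv01D f g : derivable01 f -> derivable01 g ->
  deriv01 (fun u => f u + g u) = fun u => deriv01 f u + deriv01 g u.
Proof.
move=> df dg; apply/funext => t; have [tI|tI] := boolP (t \in `[0, 1]).
  by apply: is_deriv01_eq => //; apply: is_deriv01D; apply: derivable01P tI.
by rewrite !deriv01_out// addr0.
Qed.

Lemma deriv01M f g : derivable01 f -> derivable01 g ->
  deriv01 (fun u => f u * g u) =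
  fun u => deriv01 f u * g u + f u * deriv01 g u.
Proof.
move=> df dg; apply/funext => t; have [tI|tI] := boolP (t \in `[0, 1]).
  by apply: is_deriv01_eq => //; apply: is_deriv01M; apply: derivable01P tI.
by rewrite !deriv01_out// mul0r mulr0 addr0.
Qed.

Lemma smooth01_derivable f : smooth01 f -> derivable01 f.
Proof. by move=> /(_ 0). Qed.

Lemma smooth01_deriv f : smooth01 f -> smooth01 (deriv01 f).
Proof. by move=> sf n; rewrite -iterSr; exact: sf. Qed.

Lemma smooth01_cst c : smooth01 (fun=> c).
Proof.
move=> n; have [d ->] : exists d, iter n deriv01 (fun=> c) = fun=> d.
  elim: n => [|n [d IH]]; first by exists c.
  by exists 0; rewrite iterS IH deriv01_cst.
exact: derivable01_cst.
Qed.

(* The algebra generated by smooth functions; it is closed under deriv01,     *)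
(* hence consists of smooth functions.                                        *)
Inductive smooth_alg01 : (R -> R) -> Prop :=
| SmoothAlg f of smooth01 f : smooth_alg01 f
| SmoothAlgD f g of smooth_alg01 f & smooth_alg01 g :
    smooth_alg01 (fun u => f u + g u)
| SmoothAlgM f g of smooth_alg01 f & smooth_alg01 g :
    smooth_alg01 (fun u => f u * g u).

Lemma smooth_alg01_deriv f : smooth_alg01 f ->
  derivable01 f /\ smooth_alg01 (deriv01 f).
Proof.
elim=> {f} [f sf|f g af [df af'] ag [dg ag']|f g af [df af'] ag [dg ag']].
- by split; [exact: smooth01_derivable|apply/SmoothAlg/smooth01_deriv].
- by split; [exact: derivable01D|rewrite deriv01D//; exact: SmoothAlgD].
- split; first exact: derivable01M.
  by rewrite deriv01M//; apply: SmoothAlgD; exact: SmoothAlgM.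
Qed.

Lemma smooth_alg01W f : smooth_alg01 f -> smooth01 f.
Proof.
move=> af n; apply: (smooth_alg01_deriv _).1.
by elim: n => // n IH; rewrite iterS; exact: (smooth_alg01_deriv IH).2.
Qed.

Lemma smooth01D f g : smooth01 f -> smooth01 g -> smooth01 (fun u => f u + g u).
Proof. by move=> sf sg; apply/smooth_alg01W/SmoothAlgD; exact: SmoothAlg. Qed.

Lemma smooth01M f g : smooth01 f -> smooth01 g -> smooth01 (fun u => f u * g u).
Proof. by move=> sf sg; apply/smooth_alg01W/SmoothAlgM; exact: SmoothAlg. Qed.

Lemma smooth01_sum (I : Type) (r : seq I) (F : I -> R -> R) :
  (forall i, smooth01 (F i)) -> smooth01 (fun u => \sum_(i <- r) F i u).
Proof.
move=> sF; elim: r => [|i r IH].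
  by under eq_fun do rewrite big_nil; exact: smooth01_cst.
by under eq_fun do rewrite big_cons; exact: smooth01D.
Qed.

Lemma deriv01_sum (I : Type) (r : seq I) (F : I -> R -> R) :
  (forall i, smooth01 (F i)) ->
  deriv01 (fun u => \sum_(i <- r) F i u) =
  fun u => \sum_(i <- r) deriv01 (F i) u.
Proof.
move=> sF; elim: r => [|i r IH].
  under eq_fun do rewrite big_nil; rewrite deriv01_cst.
  by apply/funext => u; rewrite big_nil.
under eq_fun do rewrite big_cons; rewrite deriv01D; last 2 first.
- exact: smooth01_derivable.
- exact/smooth01_derivable/smooth01_sum.
by rewrite IH; apply/funext => u; rewrite big_cons.
Qed.

Lemma derivable01_continuous f : derivable01 f -> {within I01, continuous f}.
Proof.
move=> df; apply/subspace_continuousP => t tI.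
have := is_deriv01_cont (derivable01P df tI).
move=> /cvgrPdist_lt ft; apply/cvgrPdist_lt => e e0.
have {}ft := ft _ e0; move: ft; rewrite !near_withinE => nft.
apply: filterS nft => u uft uI.
have [->|ut] := eqVneq u t; first by rewrite subrr normr0.
exact: uft.
Qed.

Lemma deriv01_interior f t : derivable01 f -> t \in `]0, 1[ ->
  derivable f t 1 /\ derive1 f t = deriv01 f t.
Proof.
move=> df tI; have tI' : t \in `[0, 1] by apply: subset_itv_oo_cc.
suff H : (fun h : R => h^-1 *: (f (h + t) - f t)) @ 0^' --> deriv01 f t.
  split.
    apply/cvg_ex; exists (deriv01 f t) => /=.
    by under eq_fun do rewrite [_ *: 1]mulr1.
  by rewrite derive1E /derive; under eq_fun do rewrite [_ *: 1]mulr1; exact: cvg_lim.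
have := derivable01P df tI'; rewrite /is_deriv01.
move=> /cvgrPdist_lt ft; apply/cvgrPdist_lt => e e0.
have {}ft := ft _ e0; move: ft; rewrite !near_withinE => nft.
have {}nft : \forall u \near t, (u \in `]0, 1[) /\
    (u != t -> I01 u -> `|deriv01 f t - dquot01 f t u| < e).
  exact: filterI (near_in_itvoo tI) nft.
move/nbhs0P : nft.
apply: filterS => h [tI01 ft] h0; have := ft.
rewrite -subr_eq0 addrAC subrr add0r => /(_ h0) {}ft.
rewrite [h + t]addrC; have /= := ft (subset_itv_oo_cc tI01).
by rewrite /dquot01 addrAC subrr add0r.
Qed.

Lemma is_deriv01_in f g t l : {in I01, f =1 g} -> t \in `[0, 1] ->
  is_deriv01 f t l -> is_deriv01 g t l.
Proof.
move=> fg tI; apply: cvg_trans; apply: near_eq_cvg.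
rewrite near_withinE; apply: nearW => u uI.
by rewrite /dquot01 !fg// inE.
Qed.

Lemma derivable01_in f g : {in I01, f =1 g} -> derivable01 f -> derivable01 g.
Proof.
move=> fg df t tI; apply/cvg_ex; eexists.
exact: is_deriv01_in fg tI (derivable01P df tI).
Qed.

Lemma deriv01_in f g : {in I01, f =1 g} -> derivable01 f ->
  deriv01 g = deriv01 f.
Proof.
move=> fg df; apply/funext => t; have [tI|tI] := boolP (t \in `[0, 1]).
  exact/is_deriv01_eq/(is_deriv01_in fg tI)/derivable01P.
by rewrite !deriv01_out.
Qed.

Lemma smooth01_in f g : {in I01, f =1 g} -> smooth01 f -> smooth01 g.
Proof.
move=> fg sf [|n]; first exact: derivable01_in fg (sf 0).
by rewrite iterSr (deriv01_in fg (sf 0)) -iterSr; exact: sf.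
Qed.

Lemma smooth01_id : smooth01 (fun t => t).
Proof.
have d1 t : is_deriv01 (fun u => u) t 1.
  have c1 : (fun=> 1 : R) @ within I01 t^' --> (1 : R) by exact: cvg_cst.
  rewrite /is_deriv01; apply: cvg_trans c1; apply: near_eq_cvg.
  rewrite !near_withinE.
  apply: nearW => u ut _.
  by rewrite /dquot01 mulVf// subr_eq0.
have did : derivable01 (fun t => t) by move=> t _; apply/cvg_ex; exists 1; exact: d1.
suff sid' : smooth01 (deriv01 (fun t => t)).
  by move=> [//|n]; rewrite iterSr; exact: sid'.
have d1I : {in I01, (fun=> 1) =1 deriv01 (fun t => t)}.
  by move=> t; rewrite inE => tI; rewrite (is_deriv01_eq tI (d1 t)).
exact: (smooth01_in d1I (@smooth01_cst 1)).
Qed.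

Lemma smooth01_integrable f : smooth01 f ->
  lebesgue_measure.-integrable I01 (EFin \o f).
Proof.
move=> /smooth01_derivable/derivable01_continuous cf.
by apply: continuous_compact_integrable => //; exact: segment_compact.
Qed.

Lemma Rintegral_deriv01 f : smooth01 f ->
  \int[lebesgue_measure]_(t in I01) deriv01 f t = f 1 - f 0.
Proof.
move=> sf; have df := smooth01_derivable sf; rewrite /Rintegral.
rewrite (@continuous_FTC2 _ _ f) ?EFinB//.
- exact/derivable01_continuous/smooth01_derivable/smooth01_deriv.
- have /continuous_within_itvP := derivable01_continuous df.
  move=> /(_ ltr01)[_ f0 f1].
  by split => // t tI; exact: (deriv01_interior df tI).1.
- by move=> t tI; exact: (deriv01_interior df tI).2.
Qed.

End SmoothOnUnitInterval.

Section LinearSum.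
Variables (R : realType) (U W : lmodType R).

Lemma linear_lincomb (f : U -> W) (I : Type) (r : seq I) (c : I -> R) v :
  linear f -> f (\sum_(i <- r) c i *: v i) = \sum_(i <- r) c i *: f (v i).
Proof.
move=> lf; elim: r => [|i r IH]; last by rewrite !big_cons lf IH.
rewrite !big_nil; apply: (@addrI _ (f 0)); rewrite addr0.
by have := lf 1 0 0; rewrite !scale1r addr0.
Qed.

Lemma linear_scale (f : U -> W) c v : linear f -> f (c *: v) = c *: f v.
Proof.
move=> lf; have := @linear_lincomb f _ [:: tt] (fun=> c) (fun=> v) lf.
by rewrite !big_seq1.
Qed.

Lemma linear_add (f : U -> W) u v : linear f -> f (u + v) = f u + f v.
Proof. by move=> lf; rewrite -[u]scale1r lf !scale1r. Qed.

Lemma linear_zero (f : U -> W) : linear f -> f 0 = 0.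
Proof. by move=> lf; rewrite -[X in f X](scale0r 0) linear_scale// scale0r. Qed.

Lemma linear_opp (f : U -> W) v : linear f -> f (- v) = - f v.
Proof. by move=> lf; rewrite -scaleN1r linear_scale// scaleN1r. Qed.

End LinearSum.

Section VectorCalculus.
Variables (R : realType) (V : vectType R).
Implicit Types f g : R -> V.

(* Vector-valued calculus is done in coordinates with respect to a basis;     *)
(* none of the notions below depends on its choice.                           *)
Definition vcoord (i : 'I_(\dim {:V})) : V -> R := coord (vbasis {:V}) i.

Definition vsmooth01 f : Prop := forall i, smooth01 (fun t => vcoord i (f t)).

Definition vderiv01 f (t : R) : V :=
  \sum_i deriv01 (fun u => vcoord i (f u)) t *: (vbasis {:V})`_i.

Definition vint01 f : V :=
  \sum_i (\int[lebesgue_measure]_(t in `[0, 1]) vcoord i (f t))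
    *: (vbasis {:V})`_i.

Lemma vcoord_sum (c : 'I_(\dim {:V}) -> R) i :
  vcoord i (\sum_j c j *: (vbasis {:V})`_j) = c i.
Proof. by rewrite /vcoord coord_sum_free// (basis_free (vbasisP fullv)). Qed.

Lemma vcoordK v : \sum_i vcoord i v *: (vbasis {:V})`_i = v.
Proof. by rewrite -coord_vbasis// memvf. Qed.

Lemma vcoord_linear i : linear (vcoord i).
Proof. by move=> c u v; rewrite /vcoord linearP. Qed.

Lemma vcoord_inj u v : (forall i, vcoord i u = vcoord i v) -> u = v.
Proof.
by move=> uv; rewrite -[u]vcoordK -[v]vcoordK; apply: eq_bigr => i _; rewrite uv.
Qed.

Lemma vcoord_deriv f i t :
  vcoord i (vderiv01 f t) = deriv01 (fun u => vcoord i (f u)) t.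
Proof. exact: vcoord_sum. Qed.

Lemma vcoord_int f i :
  vcoord i (vint01 f) = \int[lebesgue_measure]_(t in `[0, 1]) vcoord i (f t).
Proof. exact: vcoord_sum. Qed.

Lemma vsmooth01_deriv f : vsmooth01 f -> vsmooth01 (vderiv01 f).
Proof.
move=> sf i; under eq_fun do rewrite vcoord_deriv.
exact/smooth01_deriv/sf.
Qed.

Lemma vsmooth01D f g : vsmooth01 f -> vsmooth01 g ->
  vsmooth01 (fun t => f t + g t).
Proof.
move=> sf sg i; under eq_fun do rewrite (linear_add _ _ (vcoord_linear i)).
exact: smooth01D.
Qed.

Lemma vsmooth01Z c f : vsmooth01 f -> vsmooth01 (fun t => c *: f t).
Proof.
move=> sf i; under eq_fun do rewrite (linear_scale _ _ (vcoord_linear i)).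
by apply: (@smooth01M _ (fun=> c)); [exact: smooth01_cst|exact: sf].
Qed.

Lemma vsmooth01_cst v : vsmooth01 (fun=> v).
Proof. by move=> i; exact: smooth01_cst. Qed.

Lemma vderiv01D f g t : vsmooth01 f -> vsmooth01 g ->
  vderiv01 (fun u => f u + g u) t = vderiv01 f t + vderiv01 g t.
Proof.
move=> sf sg; apply: vcoord_inj => i.
rewrite (linear_add _ _ (vcoord_linear i)) !vcoord_deriv.
under eq_fun do rewrite (linear_add _ _ (vcoord_linear i)).
by rewrite deriv01D//; apply: smooth01_derivable.
Qed.

Lemma vderiv01Z c f t : vsmooth01 f ->
  vderiv01 (fun u => c *: f u) t = c *: vderiv01 f t.
Proof.
move=> sf; apply: vcoord_inj => i.
rewrite (linear_scale _ _ (vcoord_linear i)) !vcoord_deriv.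
under eq_fun do rewrite (linear_scale _ _ (vcoord_linear i)).
rewrite (@deriv01M _ (fun=> c)) ?deriv01_cst ?mul0r ?add0r//.
  exact: derivable01_cst.
exact/smooth01_derivable/sf.
Qed.

Lemma vint01D f g : vsmooth01 f -> vsmooth01 g ->
  vint01 (fun u => f u + g u) = vint01 f + vint01 g.
Proof.
move=> sf sg; apply: vcoord_inj => i.
rewrite (linear_add _ _ (vcoord_linear i)) !vcoord_int.
under eq_Rintegral do rewrite (linear_add _ _ (vcoord_linear i)).
by rewrite RintegralD//; apply: smooth01_integrable.
Qed.

Lemma vint01Z c f : vsmooth01 f -> vint01 (fun u => c *: f u) = c *: vint01 f.
Proof.
move=> sf; apply: vcoord_inj => i.
rewrite (linear_scale _ _ (vcoord_linear i)) !vcoord_int.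
under eq_Rintegral do rewrite (linear_scale _ _ (vcoord_linear i)).
by rewrite RintegralZl//; apply: smooth01_integrable.
Qed.

Lemma vint01_deriv f : vsmooth01 f -> vint01 (vderiv01 f) = f 1 - f 0.
Proof.
move=> sf; apply: vcoord_inj => i.
rewrite vcoord_int (linear_add _ _ (vcoord_linear i)).
rewrite (linear_opp _ (vcoord_linear i)) -(Rintegral_deriv01 (sf i)).
by under eq_Rintegral do rewrite vcoord_deriv.
Qed.

End VectorCalculus.

Section BilinearCalculus.
Variables (R : realType) (U V W : vectType R) (b : U -> V -> W).
Hypothesis b_linearl : forall v, linear (fun u => b u v).
Hypothesis b_linearr : forall u, linear (b u).
Variables (f : R -> U) (g : R -> V).
Hypotheses (sf : vsmooth01 f) (sg : vsmooth01 g).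

Lemma vcoord_bilinear k u v : vcoord k (b u v) =
  \sum_i \sum_j
    vcoord i u * (vcoord j v * vcoord k (b (vbasis {:U})`_i (vbasis {:V})`_j)).
Proof.
rewrite -[u in LHS]vcoordK (linear_lincomb _ _ _ (b_linearl v)).
rewrite (linear_lincomb _ _ _ (vcoord_linear k)); apply: eq_bigr => i _.
rewrite -[v in LHS]vcoordK (linear_lincomb _ _ _ (b_linearr _)).
rewrite (linear_lincomb _ _ _ (vcoord_linear k)).
by rewrite [LHS]mulr_sumr; apply: eq_bigr.
Qed.

Let sfg i j k : smooth01 (fun t => vcoord i (f t) * (vcoord j (g t) *
  vcoord k (b (vbasis {:U})`_i (vbasis {:V})`_j))).
Proof.
apply: smooth01M; first exact: sf.
by apply: smooth01M; [exact: sg|exact: smooth01_cst].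
Qed.

Lemma vsmooth01_bilinear : vsmooth01 (fun t => b (f t) (g t)).
Proof.
move=> k; under eq_fun do rewrite vcoord_bilinear.
by do 2 apply: smooth01_sum => ?; exact: sfg.
Qed.

Lemma vderiv01_bilinear t : vderiv01 (fun t => b (f t) (g t)) t =
  b (vderiv01 f t) (g t) + b (f t) (vderiv01 g t).
Proof.
apply: vcoord_inj => k; rewrite (linear_add _ _ (vcoord_linear k)) vcoord_deriv.
rewrite !vcoord_bilinear -big_split/=.
under eq_fun do rewrite vcoord_bilinear.
rewrite deriv01_sum; last by move=> i; apply: smooth01_sum => j; exact: sfg.
apply: eq_bigr => i _; rewrite -big_split/= deriv01_sum//.
apply: eq_bigr => j _; rewrite deriv01M; last 2 first.
- exact/smooth01_derivable/sf.
- apply: smooth01_derivable; apply: smooth01M; first exact: sg.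
  exact: smooth01_cst.
rewrite !vcoord_deriv deriv01M ?deriv01_cst ?mulr0 ?addr0//.
  exact/smooth01_derivable/sg.
exact: derivable01_cst.
Qed.

End BilinearCalculus.

Section PathSpace.
Variables (R : realType) (V : vectType R).

(* A path [0, 1] -> V is encoded by its extension by zero to R, so that two   *)
(* paths are equal if and only if they agree on [0, 1].                       *)
Definition path0 : {pred R -> V} := fun f =>
  `[< [/\ forall t, t \notin `[0, 1] -> f t = 0, vsmooth01 f & f 0 = 0] >].

Lemma path0P f : reflect
  [/\ forall t, t \notin `[0, 1] -> f t = 0, vsmooth01 f & f 0 = 0]
  (f \in path0).
Proof. exact: asboolP. Qed.

Fact path0_submod_closed : submod_closed path0.
Proof.
split.
  apply/path0P; split => //; exact: (@vsmooth01_cst _ V 0).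
move=> c f g /path0P[f0 sf f00] /path0P[g0 sg g00]; apply/path0P; split.
- by move=> t tI; rewrite !fctE f0// g0// scaler0 addr0.
- by apply: vsmooth01D => //; exact: vsmooth01Z.
- by rewrite !fctE f00 g00 scaler0 addr0.
Qed.

HB.instance Definition _ := GRing.isSubmodClosed.Build R (R -> V) path0
  path0_submod_closed.

Record P0 := P0Path { P0_fun :> R -> V; _ : P0_fun \in path0 }.

HB.instance Definition _ := [isSub for P0_fun].
HB.instance Definition _ := [Choice of P0 by <:].
HB.instance Definition _ := [SubChoice_isSubLmodule of P0 by <:].

(* The Frechet topology of P0, that is, of uniform convergence on [0, 1] of   *)
(* all derivatives.                                                           *)
Definition P0_derivatives (f : P0) :
    {ptws nat -> {uniform` [set` `[0, 1]] -> 'rV[R]_(\dim {:V})}} :=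
  fun n t => \row_i vcoord i (iter n (@vderiv01 R V) f t).

HB.instance Definition _ :=
  Topological.copy P0 (initial_topology P0_derivatives).

Definition loop0 : {pred P0} := fun f => f 1 == 0.

Fact loop0_submod_closed : submod_closed loop0.
Proof.
split; first by apply/eqP.
move=> c f g /eqP f1 /eqP g1; apply/eqP.
by rewrite /= !fctE f1 g1 scaler0 addr0.
Qed.

HB.instance Definition _ := GRing.isSubmodClosed.Build R P0 loop0
  loop0_submod_closed.

Record L0 := L0Loop { L0_path :> P0; _ : L0_path \in loop0 }.

HB.instance Definition _ := [isSub for L0_path].
HB.instance Definition _ := [Choice of L0 by <:].
HB.instance Definition _ := [SubChoice_isSubLmodule of L0 by <:].
HB.instance Definition _ := Topological.copy L0 (initial_topology L0_path).

Lemma P0_out (f : P0) t : t \notin `[0, 1] -> f t = 0.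
Proof. by case: f => f /= /path0P[f0 _ _]; exact: f0. Qed.

Lemma P0_smooth (f : P0) : vsmooth01 f.
Proof. by case: f => f /= /path0P[]. Qed.

Lemma P0_at0 (f : P0) : f 0 = 0.
Proof. by case: f => f /= /path0P[]. Qed.

Lemma L0_at1 (f : L0) : f 1 = 0.
Proof. by case: f => f /= /eqP. Qed.

Lemma P0_eq (f g : P0) : (forall t, f t = g t) -> f = g.
Proof. by move=> fg; apply/val_inj/funext. Qed.

Lemma L0_eq (f g : L0) : (forall t, f t = g t) -> f = g.
Proof. by move=> fg; apply/val_inj/P0_eq. Qed.

End PathSpace.

Arguments P0_smooth {R V} f.

Section PathLieAlgebra.
Variables (R : realType) (f : finLieAlgType R).

Fact P0_lie_subproof (X Y : P0 f) : (fun t => [lie X t, Y t]) \in @path0 R f.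
Proof.
apply/path0P; split; last by rewrite !P0_at0 lie0l.
- by move=> t tI; rewrite !P0_out// lie0l.
- apply: vsmooth01_bilinear; [exact: lie_linearl|exact: lie_linearr|..];
  exact: P0_smooth.
Qed.

Definition P0_lie (X Y : P0 f) : P0 f := P0Path (P0_lie_subproof X Y).

Fact P0_lie_linearl Y : linear (fun X => P0_lie X Y).
Proof. by move=> c X1 X2; apply: P0_eq => t /=; rewrite fctE lieDl lieZl. Qed.

Fact P0_lie_linearr X : linear (P0_lie X).
Proof. by move=> c Y1 Y2; apply: P0_eq => t /=; rewrite fctE lieDr lieZr. Qed.

Fact P0_liexx X : P0_lie X X = 0.
Proof. by apply: P0_eq => t; exact: liexx. Qed.

Fact P0_lie_jacobi X Y Z :
  P0_lie X (P0_lie Y Z) + P0_lie Y (P0_lie Z X) + P0_lie Z (P0_lie X Y) = 0.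
Proof. by apply: P0_eq => t; exact: lie_jacobi. Qed.

HB.instance Definition _ := Lmodule_isLieAlgebra.Build R (P0 f)
  P0_lie_linearl P0_lie_linearr P0_liexx P0_lie_jacobi.

Fact L0_act_subproof (X : P0 f) (Y : L0 f) : [lie X, L0_path Y] \in @loop0 R f.
Proof. by apply/eqP; rewrite /= L0_at1 lie0r. Qed.

(* L0 is an ideal of P0. *)
Definition L0_act (X : P0 f) (Y : L0 f) : L0 f := L0Loop (L0_act_subproof X Y).

Definition L0_lie (X Y : L0 f) : L0 f := L0_act X Y.

Fact L0_lie_linearl Y : linear (fun X => L0_lie X Y).
Proof. by move=> c X1 X2; apply/val_inj; exact: lie_linearl. Qed.

Fact L0_lie_linearr X : linear (L0_lie X).
Proof. by move=> c Y1 Y2; apply/val_inj; exact: lie_linearr. Qed.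

Fact L0_liexx X : L0_lie X X = 0.
Proof. by apply/val_inj; exact: liexx. Qed.

Fact L0_lie_jacobi X Y Z :
  L0_lie X (L0_lie Y Z) + L0_lie Y (L0_lie Z X) + L0_lie Z (L0_lie X Y) = 0.
Proof. by apply/val_inj; exact: lie_jacobi. Qed.

HB.instance Definition _ := Lmodule_isLieAlgebra.Build R (L0 f)
  L0_lie_linearl L0_lie_linearr L0_liexx L0_lie_jacobi.

End PathLieAlgebra.

Section Cocycle.
Variables (R : realType) (f a : finLieAlgType R) (B : sym2_ad f a).
Implicit Types X Y Z : P0 f.

Definition eta_tilde X Y : a :=
  - 2 *: vint01 (fun t => B (vderiv01 X t) (Y t)).

Let sB (F G : R -> f) : vsmooth01 F -> vsmooth01 G ->
  vsmooth01 (fun t => B (F t) (G t)).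
Proof.
exact: (vsmooth01_bilinear (sym2_linearl B) (sym2_linearr B)).
Qed.

Let sB' (X : P0 f) (F : R -> f) : vsmooth01 F ->
  vsmooth01 (fun t => B (vderiv01 X t) (F t)).
Proof. by move=> sF; apply: sB => //; exact/vsmooth01_deriv/P0_smooth. Qed.

Fact eta_tilde_linearl Y : linear (fun X => eta_tilde X Y).
Proof.
move=> c X1 X2; rewrite /eta_tilde.
rewrite (_ : (fun t => _) = fun t =>
    c *: B (vderiv01 X1 t) (Y t) + B (vderiv01 X2 t) (Y t)); last first.
  apply/funext => t; rewrite -(sym2_linearl B (Y t) c); congr (B _ _).
  rewrite -(vderiv01Z c t (P0_smooth X1)) -vderiv01D//.
    exact/vsmooth01Z/P0_smooth.
  exact: P0_smooth.
have sBY X : vsmooth01 (fun t => B (vderiv01 X t) (Y t)) by exact/sB'/P0_smooth.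
rewrite vint01D; [|exact: vsmooth01Z|exact: sBY].
rewrite vint01Z; last exact: sBY.
by rewrite scalerDr !scalerA [c * _]mulrC.
Qed.

Fact eta_tilde_linearr X : linear (eta_tilde X).
Proof.
move=> c Y1 Y2; rewrite /eta_tilde.
rewrite (_ : (fun t => _) = fun t =>
    c *: B (vderiv01 X t) (Y1 t) + B (vderiv01 X t) (Y2 t)); last first.
  by apply/funext => t; rewrite -(sym2_linearr B _ c).
have sBX Y : vsmooth01 (fun t => B (vderiv01 X t) (Y t)) by exact/sB'/P0_smooth.
rewrite vint01D; [|exact: vsmooth01Z|exact: sBX].
rewrite vint01Z; last exact: sBX.
by rewrite scalerDr !scalerA [c * _]mulrC.
Qed.

Lemma eta_tilde_sym X Y :
  eta_tilde X Y + eta_tilde Y X = - 2 *: B (X 1) (Y 1).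
Proof.
rewrite /eta_tilde -scalerDr -vint01D; [|exact/sB'/P0_smooth|exact/sB'/P0_smooth].
rewrite (_ : (fun t => _) = vderiv01 (fun t => B (X t) (Y t))); last first.
  apply/funext => t; rewrite [B (vderiv01 Y t) _]sym2_sym.
  rewrite (vderiv01_bilinear (sym2_linearl B) (sym2_linearr B)) //;
  exact: P0_smooth.
rewrite vint01_deriv; last by apply: sB; exact: P0_smooth.
by rewrite !P0_at0 (linear_zero (sym2_linearr B 0)) subr0.
Qed.

Lemma eta_tildeNC X (Y : L0 f) : eta_tilde X Y = - eta_tilde Y X.
Proof.
apply/eqP; rewrite -addr_eq0 eta_tilde_sym L0_at1.
by rewrite (linear_zero (sym2_linearr B _)) scaler0.
Qed.

Lemma eta_tilde_cocycle X Y Z :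
  eta_tilde [lie X, Y] Z + eta_tilde Y [lie X, Z] = eta_tilde X [lie Y, Z].
Proof.
have dXY t : vderiv01 [lie X, Y] t =
    [lie vderiv01 X t, Y t] + [lie X t, vderiv01 Y t].
  rewrite (vderiv01_bilinear (@lie_linearl _ _) (@lie_linearr _ _)) //;
  exact: P0_smooth.
rewrite /eta_tilde -scalerDr -vint01D; last 2 first.
- exact/sB'/P0_smooth.
- exact/sB'/P0_smooth.
congr (_ *: vint01 _); apply/funext => t.
rewrite dXY (linear_add _ _ (sym2_linearl B _)) !sym2_ad_inv -addrA.
rewrite -[RHS]addr0; congr (_ + _).
rewrite -[B (X t) _]sym2_ad_inv lieNC -[B (vderiv01 Y t) _]sym2_ad_inv.
by rewrite (linear_opp _ (sym2_linearl B _)) addNr.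
Qed.

End Cocycle.

Definition L0ext (R : realType) (f a : finLieAlgType R) (B : sym2_ad f a) :
  Type := (L0 f * a)%type.

Section CentralExtension.
Variables (R : realType) (f a : finLieAlgType R) (B : sym2_ad f a).

HB.instance Definition _ := GRing.Lmodule.copy (L0ext B) (L0 f * a)%type.

(* The product topology of the topology of L0 and the Euclidean topology of a.*)
Definition L0ext_coord (x : L0ext B) : L0 f * 'rV[R]_(\dim {:a}) :=
  (x.1, \row_i vcoord i x.2).

HB.instance Definition _ :=
  Topological.copy (L0ext B) (initial_topology L0ext_coord).

Definition L0ext_lie (x y : L0ext B) : L0ext B :=
  ([lie x.1, y.1], eta_tilde B x.1 y.1).

Lemma L0ext_eq (x y : L0ext B) : x.1 = y.1 -> x.2 = y.2 -> x = y.
Proof. by case: x y => [? ?] [? ?] /= -> ->. Qed.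

Fact L0ext_lie_linearl y : linear (fun x => L0ext_lie x y).
Proof.
move=> c x1 x2; apply: L0ext_eq; first exact: lie_linearl.
exact: eta_tilde_linearl.
Qed.

Fact L0ext_lie_linearr x : linear (L0ext_lie x).
Proof.
move=> c x1 x2; apply: L0ext_eq; first exact: lie_linearr.
exact: eta_tilde_linearr.
Qed.

Fact L0ext_liexx x : L0ext_lie x x = 0.
Proof.
apply: L0ext_eq; first exact: liexx.
have /eqP := eta_tildeNC B x.1 x.1; rewrite -addr_eq0 -mulr2n -scaler_nat.
by rewrite scaler_eq0 pnatr_eq0 => /eqP.
Qed.

Fact L0ext_lie_jacobi x y z :
  L0ext_lie x (L0ext_lie y z) + L0ext_lie y (L0ext_lie z x) +
  L0ext_lie z (L0ext_lie x y) = 0.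
Proof.
apply: L0ext_eq; first exact: lie_jacobi.
rewrite /= -eta_tilde_cocycle (eta_tildeNC B z.1 [lie x.1, y.1]) -addrA.
rewrite [[lie L0_path z.1, _]]lieNC.
rewrite (linear_opp _ (eta_tilde_linearr B _)).
by rewrite [- _ - _]addrC addrACA !subrr addr0.
Qed.

HB.instance Definition _ := Lmodule_isLieAlgebra.Build R (L0ext B)
  L0ext_lie_linearl L0ext_lie_linearr L0ext_liexx L0ext_lie_jacobi.

Definition GB_t (x : L0ext B) : P0 f := L0_path x.1.

Fact GB_t_linear : linear GB_t.
Proof. by []. Qed.

HB.instance Definition _ :=
  GRing.isLinear.Build R (L0ext B) (P0 f) *:%R GB_t GB_t_linear.

Definition GB_alpha (X : P0 f) (y : L0ext B) : L0ext B :=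
  (L0_act X y.1, eta_tilde B X y.1).

Fact GB_t_lie : lie_morphism GB_t.
Proof. by []. Qed.

Fact GB_alpha_linearl x : linear (fun X => GB_alpha X x).
Proof.
move=> c X1 X2; apply: L0ext_eq; last exact: eta_tilde_linearl.
by apply/val_inj; exact: lie_linearl.
Qed.

Fact GB_alpha_linearr X : linear (GB_alpha X).
Proof.
move=> c x1 x2; apply: L0ext_eq; last exact: eta_tilde_linearr.
by apply/val_inj; exact: lie_linearr.
Qed.

Fact GB_alpha_der X x y :
  GB_alpha X [lie x, y] = [lie GB_alpha X x, y] + [lie x, GB_alpha X y].
Proof.
apply: L0ext_eq; first by apply/val_inj; exact: lie_leibniz.
by rewrite /= -eta_tilde_cocycle.
Qed.

Fact GB_alpha_lie X Y x : GB_alpha [lie X, Y] x =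
  GB_alpha X (GB_alpha Y x) - GB_alpha Y (GB_alpha X x).
Proof.
apply: L0ext_eq.
  by apply/val_inj => /=; rewrite [in RHS]lie_leibniz addrK.
by rewrite /= -[eta_tilde B X _]eta_tilde_cocycle addrK.
Qed.

Fact GB_equivariant X x : GB_t (GB_alpha X x) = [lie X, GB_t x].
Proof. by []. Qed.

Fact GB_peiffer x y : GB_alpha (GB_t x) y = [lie x, y].
Proof. by apply: L0ext_eq => //; exact/val_inj. Qed.

Definition GB : lie_crossed_module (L0ext B) (P0 f) :=
  LieCrossedModule (cm_t := GB_t) GB_t_lie GB_alpha_linearl GB_alpha_linearr
    GB_alpha_der GB_alpha_lie GB_equivariant GB_peiffer.

Definition ev1 (X : P0 f) : f := X 1.

Fact ev1_linear : linear ev1.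
Proof. by []. Qed.

HB.instance Definition _ :=
  GRing.isLinear.Build R (P0 f) f *:%R ev1 ev1_linear.

Fact ev1_lie : lie_morphism ev1.
Proof. by []. Qed.

Fact ev1_surj x : exists X, ev1 X = x.
Proof.
pose X (t : R) := if t \in `[0, 1] then t *: x else 0.
have X0 : X \in @path0 R f.
  apply/path0P; split; last by rewrite /X scale0r if_same.
    by move=> t /negbTE tI; rewrite /X tI.
  move=> i; apply: (@smooth01_in _ (fun t => t * vcoord i x)).
    move=> t; rewrite inE /= /X => ->.
    by rewrite (linear_scale _ _ (vcoord_linear i)).
  by apply: smooth01M; [exact: smooth01_id|exact: smooth01_cst].
exists (P0Path X0).
by rewrite /ev1 /= /X in_itv/= ler01 lexx scale1r.
Qed.

Fact ev1_ker X : ev1 X = 0 <-> exists x, X = GB_t x.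
Proof.
split=> [/eqP X1|[x ->]]; last exact: L0_at1.
by exists ((L0Loop X1 : L0 f, 0) : L0ext B).
Qed.

Definition GB_incl (u : a) : L0ext B := (0, u).

Fact GB_incl_linear : linear GB_incl.
Proof. by move=> c u v; apply: L0ext_eq => //=; rewrite scaler0 addr0. Qed.

HB.instance Definition _ :=
  GRing.isLinear.Build R a (L0ext B) *:%R GB_incl GB_incl_linear.

Hypothesis a_abelian : lie_abelian a.

Fact GB_incl_lie : lie_morphism GB_incl.
Proof.
move=> u v; apply: L0ext_eq => /=; first by rewrite lie0r.
by rewrite a_abelian (linear_zero (eta_tilde_linearr B 0)).
Qed.

Fact GB_incl_inj : injective GB_incl.
Proof. by move=> u v []. Qed.

Fact GB_incl_im x : GB_t x = 0 <-> exists u, x = GB_incl u.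
Proof.
split=> [x0|[u ->] //]; exists x.2; apply: L0ext_eq => //=.
exact/val_inj.
Qed.

(* ker t = a and P0 / L0 = f through evaluation at 1. *)
Definition GB_homotopy : cm_homotopy GB f a :=
  CMHomotopy (G := GB) (cm_p := ev1) ev1_lie ev1_surj ev1_ker
    (cm_i := GB_incl) GB_incl_lie GB_incl_inj GB_incl_im.

Variable s : cm_section GB_homotopy.

Fact eta_Bs_subproof (X Y : P0 f) :
  [lie X, Y] - s [lie X 1, Y 1] \in @loop0 R f.
Proof.
apply/eqP; rewrite -/(ev1 _) (linear_add _ _ ev1_linear).
by rewrite (linear_opp _ ev1_linear) (section_funK s) subrr.
Qed.

Definition eta_Bs (X Y : P0 f) : L0ext B :=
  (L0Loop (eta_Bs_subproof X Y), eta_tilde B X Y).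

End CentralExtension.

(* Main.v *)
Require Import Defs.
From mathcomp Require Import all_boot all_order all_algebra.
From mathcomp Require Import all_classical all_reals all_analysis.
From mathcomp Require Import lra.

(** The algebraic part follows from the properties of
    eta_tilde(X, Y) = -2 int B(X', Y). It satisfies the same Leibniz-type
    identity as the bracket (eta_tilde_cocycle), because B is ad-invariant;
    integration by parts turns its symmetric part into the boundary term
    - B(X(1), Y(1)), which vanishes as soon as one argument is a loop. Hence the
    a-component of eta_Bs is the a-component of alpha on loops, up to the sign
    demanded of an adjustment, and its symmetrization is -B evaluated at the
    endpoints. In the path component, the bracket and the correction
    s([X(1), Y(1)]) are antisymmetric, so symmetrization kills them; the
    correction obeys the Leibniz identity because s is linear and the bracket of
    f does, and it vanishes when X or Y is a loop, as loops end at 0. The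
    form B is the only one with this symmetric part since ev_1 is surjective and
    the inclusion of a is injective (KLadj_unique).

    The analytic part is the continuity of eta_Bs for the Frechet topology. A
    filter converges in P0 exactly when every coordinate of every derivative
    converges uniformly on [0, 1] (P0_cvgP). This mode of convergence passes
    to products, by induction on the order of the derivative
    (smooth_cvg01M), hence to every pointwise bilinear operation, in particular
    to [X, Y] and B(X', Y); it implies convergence of the integrals
    (smooth_cvg01_int) and of the values at 1. Finally s, being linear with a
    finite-dimensional source, is continuous into P0 (vsmooth_cvg01_linear). *)

Set Implicit Arguments.
Unset Strict Implicit.
Unset Printing Implicit Defensive.

Import Order.TTheory GRing.Theory Num.Theory.
Import numFieldNormedType.Exports.

Local Open Scope classical_set_scope.
Local Open Scope ring_scope.

(** * Smooth functions on the unit interval *)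

Section SmoothScalar.
Variable R : realType.
Implicit Types f g : R -> R.

Lemma iter_deriv01D n f g : smooth01 f -> smooth01 g ->
  iter n (@deriv01 R) (fun t => f t + g t) =
  fun t => iter n (@deriv01 R) f t + iter n (@deriv01 R) g t.
Proof.
elim: n f g => // n IH f g sf sg; rewrite !iterSr deriv01D//.
- by apply: IH; exact: smooth01_deriv.
- exact: smooth01_derivable.
- exact: smooth01_derivable.
Qed.

Lemma iterS_deriv01M n f g : smooth01 f -> smooth01 g ->
  iter n.+1 (@deriv01 R) (fun t => f t * g t) =
  fun t => iter n (@deriv01 R) (fun u => deriv01 f u * g u) t +
           iter n (@deriv01 R) (fun u => f u * deriv01 g u) t.
Proof.
move=> sf sg; rewrite iterSr deriv01M; [|exact: smooth01_derivable..].
by apply: iter_deriv01D; apply: smooth01M => //; exact: smooth01_deriv.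
Qed.

Lemma iter_deriv01_cst n (c : R) :
  iter n (@deriv01 R) (fun=> c) = fun=> if n is 0%N then c else 0.
Proof. by elim: n => // n IH; rewrite iterS IH deriv01_cst. Qed.

Lemma smooth01_bounded f : smooth01 f ->
  exists2 M, 0 <= M & forall t, t \in `[0, 1] -> `|f t| <= M.
Proof.
move=> /smooth01_derivable/derivable01_continuous cf.
have [c _ fc] := EVT_max ler01 cf.
have [d _ fd] := EVT_min ler01 cf.
exists (`|f c| + `|f d|); first exact: addr_ge0.
move=> t tI; have ftc := fc t tI; have fdt := fd t tI.
have := ler_norm (f c); have := ler_norm (- f d); rewrite normrN => fd1 fc1.
by rewrite ler_norml; have := normr_ge0 (f c); have := normr_ge0 (f d); lra.
Qed.

End SmoothScalar.

(** * Uniform convergence of all derivatives *)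

Section SmoothConvergence.
Variables (R : realType) (T : Type) (F : set_system T).
Context {FF : Filter F}.
Implicit Types (f g : R -> R) (phi psi : T -> R -> R).

(** The indexed family phi converges to f along F, an arbitrary filter on the
    index type, so that the neighbourhoods of a pair of paths can be used as F
    without reducing to sequences. *)
Definition unif_cvg01 phi f : Prop := forall e, 0 < e ->
  \forall x \near F, forall t, t \in `[0, 1] -> `|f t - phi x t| < e.

(** Smoothness of all the functions belongs to the notion because deriv01 obeys
    the sum and product rules only on differentiable functions. *)
Definition smooth_cvg01 phi f : Prop :=
  [/\ forall x, smooth01 (phi x), smooth01 f & forall n,
    unif_cvg01 (fun x => iter n (@deriv01 R) (phi x)) (iter n (@deriv01 R) f)].

Lemma unif_cvg01D phi f psi g : unif_cvg01 phi f -> unif_cvg01 psi g ->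
  unif_cvg01 (fun x t => phi x t + psi x t) (fun t => f t + g t).
Proof.
move=> cf cg e e0; have e20 : 0 < e / 2 by rewrite divr_gt0.
have fF := cf _ e20; have gF := cg _ e20.
apply: filterS2 fF gF => x fx gx t tI.
rewrite opprD addrACA (le_lt_trans (ler_normD _ _))//.
by have := fx t tI; have := gx t tI; lra.
Qed.

(** The usual splitting f g - phi psi = (f - phi) g + phi (g - psi); it needs
    bounded limits, which smoothness on the compact interval gives. *)
Lemma unif_cvg01M phi f psi g : smooth01 f -> smooth01 g ->
  unif_cvg01 phi f -> unif_cvg01 psi g ->
  unif_cvg01 (fun x t => phi x t * psi x t) (fun t => f t * g t).
Proof.
move=> /smooth01_bounded[M M0 fM] /smooth01_bounded[N N0 gN] cf cg e e0.
(* The two error terms are at most d N and (M + 1) d, as |phi| <= M + 1 once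
   d <= 1; K is the sum of the two factors. *)
pose K := M + N + 1; have K0 : 0 < K by rewrite /K; lra.
pose d := Num.min 1 (e / K).
have d0 : 0 < d by rewrite lt_min ltr01 divr_gt0.
have d1 : d <= 1 by rewrite ge_min lexx.
have dK : d * K <= e by rewrite -ler_pdivlMr// ge_min lexx orbT.
have fF := cf _ d0; have gF := cg _ d0.
apply: filterS2 fF gF => x fx gx t tI.
have {}fx := fx t tI; have {}gx := gx t tI.
have {}fM := fM t tI; have {}gN := gN t tI.
have phiM : `|phi x t| <= M + 1.
  rewrite -[phi x t](subKr (f t)) (le_trans (ler_normB _ _))//.
  by apply: lerD => //; apply: le_trans d1; exact: ltW.
rewrite (_ : _ - _ = (f t - phi x t) * g t + phi x t * (g t - psi x t));
  last first.
  by rewrite mulrBl mulrBr addrA subrK.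
rewrite (le_lt_trans (ler_normD _ _))// !normrM.
apply: lt_le_trans dK; rewrite (_ : d * K = d * N + (M + 1) * d); last first.
  by rewrite /K; lra.
apply: ler_ltD; first by apply: ler_pM => //; exact: ltW.
apply: (@le_lt_trans _ _ ((M + 1) * `|g t - psi x t|)).
  by apply: ler_wpM2r.
by rewrite ltr_pM2l//; lra.
Qed.

Lemma smooth_cvg01_cst f : smooth01 f -> smooth_cvg01 (fun=> f) f.
Proof.
by move=> sf; split=> // n e e0; apply: nearW => x t _; rewrite subrr normr0.
Qed.

Lemma smooth_cvg01_deriv phi f : smooth_cvg01 phi f ->
  smooth_cvg01 (fun x => deriv01 (phi x)) (deriv01 f).
Proof.
move=> [sphi sf cf]; split=> [x||n]; [exact: smooth01_deriv..|].
by move=> e e0; have := cf n.+1 e e0; under eq_near do rewrite !iterSr.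
Qed.

Lemma smooth_cvg01D phi f psi g : smooth_cvg01 phi f -> smooth_cvg01 psi g ->
  smooth_cvg01 (fun x t => phi x t + psi x t) (fun t => f t + g t).
Proof.
move=> [sphi sf cf] [spsi sg cg]; split=> [x||n]; [exact: smooth01D..|].
rewrite iter_deriv01D//; under eq_fun do rewrite iter_deriv01D//.
exact: unif_cvg01D.
Qed.

(** Induction on the order of the derivative, for all pairs of families at once:
    the derivative of order n + 1 of a product is the derivative of order n of
    phi' psi + phi psi', to which the induction hypothesis applies. This avoids
    the binomial form of the Leibniz rule. *)
Lemma smooth_cvg01M phi f psi g : smooth_cvg01 phi f -> smooth_cvg01 psi g ->
  smooth_cvg01 (fun x t => phi x t * psi x t) (fun t => f t * g t).
Proof.
move=> cf cg; split=> [x||n].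
- by case: cf cg => sphi _ _ [spsi _ _]; exact: smooth01M.
- by case: cf cg => _ sf _ [_ sg _]; exact: smooth01M.
elim: n phi f psi g cf cg => [|n IH] phi f psi g cf cg.
  by case: cf cg => _ sf cf [_ sg cg]; exact: unif_cvg01M (cf 0%N) (cg 0%N).
have cf' := smooth_cvg01_deriv cf; have cg' := smooth_cvg01_deriv cg.
have := unif_cvg01D (IH _ _ _ _ cf' cg) (IH _ _ _ _ cf cg').
case: cf cg => sphi sf _ [spsi sg _].
rewrite (iterS_deriv01M n sf sg).
rewrite (_ : (fun x => iter n.+1 _ _) = fun x t =>
    iter n (@deriv01 R) (fun u => deriv01 (phi x) u * psi x u) t +
    iter n (@deriv01 R) (fun u => phi x u * deriv01 (psi x) u) t) //.
by apply/funext => x; exact: iterS_deriv01M.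
Qed.

Lemma smooth_cvg01_sum (I : Type) (r : seq I) (Phi : I -> T -> R -> R)
    (G : I -> R -> R) : (forall i, smooth_cvg01 (Phi i) (G i)) ->
  smooth_cvg01 (fun x t => \sum_(i <- r) Phi i x t)
    (fun t => \sum_(i <- r) G i t).
Proof.
move=> cG; elim: r => [|i r IH].
  under eq_fun do under eq_fun do rewrite big_nil.
  under [X in smooth_cvg01 _ X]eq_fun do rewrite big_nil.
  exact/smooth_cvg01_cst/smooth01_cst.
under eq_fun do under eq_fun do rewrite big_cons.
under [X in smooth_cvg01 _ X]eq_fun do rewrite big_cons.
exact: smooth_cvg01D.
Qed.

(** The value at a point, seen as a constant function, so that expressions that
    mix paths and endpoint values are handled by the same closure rules. *)
Lemma smooth_cvg01_at phi f t0 : t0 \in `[0, 1] -> smooth_cvg01 phi f ->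
  smooth_cvg01 (fun x _ => phi x t0) (fun=> f t0).
Proof.
move=> t0I [sphi sf cf]; split=> [x||n]; [exact: smooth01_cst..|].
rewrite iter_deriv01_cst; under eq_fun do rewrite iter_deriv01_cst.
move=> e e0; case: n => [|n];
  last by apply: nearW => x t _; rewrite subrr normr0.
have := cf 0%N e e0; apply: filterS => x fx t _; exact: fx.
Qed.

(** The interval has length 1, so the integrals differ by at most the uniform
    distance. *)
Lemma smooth_cvg01_int phi f : smooth_cvg01 phi f ->
  \int[lebesgue_measure]_(t in `[0, 1]) phi x t @[x --> F] -->
  \int[lebesgue_measure]_(t in `[0, 1]) f t.
Proof.
move=> [sphi sf cf]; apply/cvgrPdist_le => e e0.
have := cf 0%N e e0; apply: filterS => x fx /=.
have iB : lebesgue_measure.-integrable [set` `[0, 1]]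
    (EFin \o (fun t => f t - phi x t)).
  apply: smooth01_integrable; under eq_fun do rewrite -[- phi _ _]mulN1r.
  by apply: smooth01D => //; apply: smooth01M => //; exact: smooth01_cst.
rewrite -RintegralB//; [|exact: smooth01_integrable..].
apply: (le_trans (le_normr_Rintegral _ _)) => //.
rewrite (_ : e = \int[lebesgue_measure]_(t in `[0, 1]) (e : R)); last first.
  rewrite Rintegral_cst//= lebesgue_measure_itv/= lte_fin ltr01.
  by rewrite -EFinB subr0 mulr1.
apply: le_Rintegral => //.
- exact: integrable_norm.
- by apply: smooth01_integrable; exact: smooth01_cst.
- by move=> t tI; apply/ltW/fx.
Qed.

End SmoothConvergence.

(** * The Frechet topology on path spaces *)

Section InitialTopology.

Lemma cvg_initial (S : choiceType) (U : topologicalType) (w : S -> U)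
    (F : set_system S) (x : S) : Filter F ->
  w @ F --> w x -> F --> (x : initial_topology w).
Proof.
move=> FF wF A /= [_ [[B oB <-] Bwx] /filterS]; apply.
by apply: wF; exact: open_nbhs_nbhs.
Qed.

Lemma cvg_ptws (I : Type) (U : topologicalType) (F : set_system (I -> U))
    (f : I -> U) : Filter F ->
  (forall i, g i @[g --> F] --> f i) -> F --> (f : {ptws I -> U}).
Proof. by move=> FF Ff; apply/cvg_sup => i; exact: cvg_initial (Ff i). Qed.

Lemma cvg_mx (R : realType) m n (T : Type) (F : set_system T)
    (M : T -> 'M[R]_(m, n)) (M0 : 'M[R]_(m, n)) : Filter F ->
  (forall i j, M x i j @[x --> F] --> M0 i j) -> M @ F --> M0.
Proof.
move=> FF cM; apply/cvg_ballP => e e0.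
have : \forall x \near F, forall i j, ball (M0 i j) e (M x i j).
  apply: filter_forall => i; apply: filter_forall => j.
  by have /cvg_ballP := cM i j; exact.
by apply: filterS => x xe; split.
Qed.

End InitialTopology.

Section VectorSmoothConvergence.
Variables (R : realType) (T : Type) (F : set_system T).
Context {FF : Filter F}.

Definition vsmooth_cvg01 (V : vectType R) (G : T -> R -> V) (g : R -> V) :=
  forall i, smooth_cvg01 F (fun x t => vcoord i (G x t))
    (fun t => vcoord i (g t)).

Section Bilinear.
Variables (U V W : vectType R) (b : U -> V -> W).
Hypothesis b_linearl : forall v, linear (fun u => b u v).
Hypothesis b_linearr : forall u, linear (b u).

(** In coordinates, a bilinear map is a quadratic polynomial with constant
    coefficients. *)
Lemma vsmooth_cvg01_bilinear G g H h :
  vsmooth_cvg01 G g -> vsmooth_cvg01 H h ->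
  vsmooth_cvg01 (fun x t => b (G x t) (H x t)) (fun t => b (g t) (h t)).
Proof.
move=> cG cH k; have bE := vcoord_bilinear b_linearl b_linearr k.
under eq_fun do under eq_fun do rewrite bE.
under [X in smooth_cvg01 _ _ X]eq_fun do rewrite bE.
apply: smooth_cvg01_sum => i; apply: smooth_cvg01_sum => j.
apply: smooth_cvg01M; first exact: cG.
by apply: smooth_cvg01M; [exact: cH|apply/smooth_cvg01_cst/smooth01_cst].
Qed.

End Bilinear.

Variable V : vectType R.
Implicit Types (G : T -> R -> V) (g : R -> V).

Lemma vsmooth_cvg01B G g H h : vsmooth_cvg01 G g -> vsmooth_cvg01 H h ->
  vsmooth_cvg01 (fun x t => G x t - H x t) (fun t => g t - h t).
Proof.
move=> cG cH i.
have subE u v : vcoord i (u - v : V) = vcoord i u + -1 * vcoord i v.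
  by rewrite addrC -scaleN1r vcoord_linear addrC.
under eq_fun do under eq_fun do rewrite subE.
under [X in smooth_cvg01 _ _ X]eq_fun do rewrite subE.
apply: smooth_cvg01D; first exact: cG.
by apply: smooth_cvg01M; [apply/smooth_cvg01_cst/smooth01_cst|exact: cH].
Qed.

Lemma vsmooth_cvg01_deriv G g : vsmooth_cvg01 G g ->
  vsmooth_cvg01 (fun x => vderiv01 (G x)) (vderiv01 g).
Proof.
move=> cG i; under eq_fun do under eq_fun do rewrite vcoord_deriv.
under [X in smooth_cvg01 _ _ X]eq_fun do rewrite vcoord_deriv.
exact/smooth_cvg01_deriv/cG.
Qed.

Lemma vsmooth_cvg01_at G g t0 : t0 \in `[0, 1] -> vsmooth_cvg01 G g ->
  vsmooth_cvg01 (fun x _ => G x t0) (fun=> g t0).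
Proof. by move=> t0I cG i; exact: smooth_cvg01_at t0I (cG i). Qed.

Lemma vcoord_int_cvg G g i : vsmooth_cvg01 G g ->
  vcoord i (vint01 (G x)) @[x --> F] --> vcoord i (vint01 g).
Proof.
move=> cG; under eq_fun do rewrite vcoord_int; rewrite vcoord_int.
by apply: smooth_cvg01_int; exact: cG.
Qed.

Lemma vcoord_iter_deriv n g i t :
  vcoord i (iter n (@vderiv01 R V) g t) =
  iter n (@deriv01 R) (fun u => vcoord i (g u)) t.
Proof.
elim: n g => // n IH g; rewrite !iterSr IH.
by congr (iter n _ _ t); apply/funext => u; exact: vcoord_deriv.
Qed.

(** The bridge between the topology of P0, which is the initial topology for the
    sequence of derivatives, and convergence of the coordinate functions, where
    the closure rules for sums and products live. *)
Lemma P0_cvgP (G : T -> P0 V) (g : P0 V) :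
  G @ F --> g <-> vsmooth_cvg01 G g.
Proof.
split=> [Gg i|cG].
  split=> [x||n]; [exact: P0_smooth..|move=> e e0].
  have : nbhs g [set h : P0 V | forall t, t \in `[0, 1] ->
      ball (P0_derivatives g n t) e (P0_derivatives h n t)].
    have gn : nbhs (P0_derivatives g n) [set h :
        {uniform` [set` `[0, 1]] -> 'rV[R]_(\dim {:V})} | forall t,
          t \in `[0, 1] -> ball (P0_derivatives g n t) e (h t)].
      apply/uniform_nbhs; exists [set xy | ball xy.1 e xy.2]; split => //.
      by rewrite -entourage_ballE; exists e.
    have := @proj_continuous nat (fun=> {uniform` [set` `[0, 1]] ->
      'rV[R]_(\dim {:V})}) n (P0_derivatives g) _ gn.
    exact: (@initial_continuous (P0 V) _ (@P0_derivatives R V) g).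
  move=> /Gg; apply: (@filterS _ F) => x /= xe t tI.
  have [_ /(_ ord0 i)] := xe t tI.
  by rewrite !mxE /ball/= !vcoord_iter_deriv.
apply: cvg_initial; apply: cvg_ptws => n.
move=> A /uniform_nbhs[E [entE EA]].
have /= [e e0 eE] : exists2 e : R, 0 < e & [set xy | ball xy.1 e xy.2] `<=` E.
  by move: entE; rewrite -entourage_ballE => -[e /= e0 eE]; exists e.
have : \forall x \near F, forall i t, t \in `[0, 1] ->
    `|iter n (@deriv01 R) (fun u => vcoord i (g u)) t -
      iter n (@deriv01 R) (fun u => vcoord i (G x u)) t| < e.
  by apply: filter_forall => i; have [_ _ /(_ n e e0)] := cG i.
apply: filterS => x xe; apply: EA => t tI; apply: eE; split => // i j.
by rewrite !mxE /ball/= !vcoord_iter_deriv; exact: xe.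
Qed.

End VectorSmoothConvergence.

(** * The adjustment on the crossed module of paths and loops *)

Section AdjustmentContinuous.
Variables (R : realType) (T : Type) (F : set_system T).
Context {FF : Filter F}.

(** A linear map l out of a finite-dimensional space is continuous into P0:
    l(u) is the combination of the fixed paths l(e_k) with the coordinates of u
    as coefficients, and those converge. *)
Lemma vsmooth_cvg01_linear (V W : vectType R) (l : {linear V -> P0 W})
    (v : T -> V) (v0 : V) :
  vsmooth_cvg01 F (fun x _ => v x) (fun=> v0) ->
  vsmooth_cvg01 F (fun x => l (v x)) (l v0).
Proof.
move=> cv i.
have lE u t : vcoord i (l u t) =
    \sum_k vcoord k u * vcoord i (l (vbasis {:V})`_k t).
  have lt_lin : linear (fun u => l u t) by move=> c u1 u2; rewrite linearP.
  rewrite -[u in LHS]vcoordK (linear_lincomb _ _ _ lt_lin).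
  by rewrite (linear_lincomb _ _ _ (vcoord_linear i)).
under eq_fun do under eq_fun do rewrite lE.
under [X in smooth_cvg01 _ _ X]eq_fun do rewrite lE.
apply: smooth_cvg01_sum => k; apply: smooth_cvg01M; first exact: cv.
exact/smooth_cvg01_cst/P0_smooth.
Qed.

Lemma L0ext_cvg (f a : finLieAlgType R) (B : sym2_ad f a)
    (G : T -> L0ext B) (g : L0ext B) :
  vsmooth_cvg01 F (fun x => L0_path (G x).1) (L0_path g.1) ->
  (forall i, vcoord i (G x).2 @[x --> F] --> vcoord i g.2) ->
  G @ F --> g.
Proof.
move=> cG1 cG2; apply: cvg_initial.
have cL : (G x).1 @[x --> F] --> g.1.
  apply: cvg_initial.
  exact: (P0_cvgP (fun x => L0_path (G x).1) (L0_path g.1)).2 cG1.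
have ca : \row_i vcoord i (G x).2 @[x --> F] --> \row_i vcoord i g.2.
  by apply: cvg_mx => i j; rewrite mxE; under eq_fun do rewrite mxE; exact: cG2.
exact: cvg_pair cL ca.
Qed.

End AdjustmentContinuous.

Section Adjustment.
Variables (R : realType) (f a : finLieAlgType R) (B : sym2_ad f a).
Hypothesis a_abelian : lie_abelian a.
Variable s : cm_section (GB_homotopy B a_abelian).
Implicit Types X Y Z : P0 f.

Lemma eta_Bs_continuous :
  continuous (fun XY : P0 f * P0 f => eta_Bs s XY.1 XY.2).
Proof.
move=> [X0 Y0]; pose F := nbhs (X0, Y0).
have FF : Filter F by exact: nbhs_filter.
have cX : vsmooth_cvg01 F (fun XY => P0_fun XY.1) X0.
  by apply: (P0_cvgP (fun XY => XY.1) X0).1; exact: cvg_fst.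
have cY : vsmooth_cvg01 F (fun XY => P0_fun XY.2) Y0.
  by apply: (P0_cvgP (fun XY => XY.2) Y0).1; exact: cvg_snd.
have cXY : vsmooth_cvg01 F (fun XY t => [lie XY.1 t, XY.2 t])
    (fun t => [lie X0 t, Y0 t]).
  exact: (vsmooth_cvg01_bilinear (@lie_linearl _ f) (@lie_linearr _ f) cX cY).
have I1 : (1 : R) \in `[0, 1] by rewrite in_itv/= ler01 lexx.
have cs : vsmooth_cvg01 F (fun XY => s [lie XY.1 1, XY.2 1])
    (s [lie X0 1, Y0 1]).
  exact: (vsmooth_cvg01_linear (section_fun s) (vsmooth_cvg01_at I1 cXY)).
apply: L0ext_cvg => [|i]; first exact: vsmooth_cvg01B cXY cs.
have cB : vsmooth_cvg01 F (fun XY t => B (vderiv01 XY.1 t) (XY.2 t))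
    (fun t => B (vderiv01 X0 t) (Y0 t)).
  exact: (vsmooth_cvg01_bilinear (sym2_linearl B) (sym2_linearr B)
    (vsmooth_cvg01_deriv cX) cY).
rewrite /= (linear_scale _ _ (vcoord_linear i)).
under eq_fun do rewrite (linear_scale _ _ (vcoord_linear i)).
by apply: cvgM; [exact: cvg_cst|exact: vcoord_int_cvg].
Qed.

(** In the path component this is the Jacobi identity, twice: for paths, and
    under s for their endpoints. *)
Lemma eta_Bs_cocycle X Y Z :
  eta_Bs s [lie X, Y] Z + eta_Bs s Y [lie X, Z] = eta_Bs s X [lie Y, Z].
Proof.
apply: L0ext_eq; last exact: eta_tilde_cocycle.
apply/val_inj => /=; rewrite addrACA -lie_leibniz -opprD -linearD/=.
by rewrite -lie_leibniz.
Qed.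

Lemma eta_Bs_adjustment : is_infinitesimal_adjustment (GB B) (eta_Bs s).
Proof.
split.
- move=> Y c X1 X2; apply: L0ext_eq; last exact: eta_tilde_linearl.
  apply/val_inj => /=; rewrite lie_linearl scalerBr addrACA -opprD.
  congr (_ - _); rewrite -(linearP (section_fun s)); congr (s _).
  exact: lie_linearl.
- move=> X c Y1 Y2; apply: L0ext_eq; last exact: eta_tilde_linearr.
  apply/val_inj => /=; rewrite lie_linearr scalerBr addrACA -opprD.
  congr (_ - _); rewrite -(linearP (section_fun s)); congr (s _).
  exact: lie_linearr.
- exact: eta_Bs_continuous.
- exact: eta_Bs_cocycle.
- move=> x Y; apply: L0ext_eq => /=.
    apply/val_inj => /=; rewrite /GB_t L0_at1 lie0l linear0 subr0.
    by rewrite lieNC.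
  by rewrite (eta_tildeNC B Y x.1) opprK.
- move=> X y; apply: L0ext_eq => //=.
  by apply/val_inj => /=; rewrite /GB_t L0_at1 lie0r linear0 subr0.
Qed.

Lemma eta_Bs_adapted : is_adapted s (eta_Bs s).
Proof. by []. Qed.

Lemma eta_Bs_symmetric_part X Y :
  2^-1 *: (eta_Bs s X Y + eta_Bs s Y X) = - GB_incl B (B (X 1) (Y 1)).
Proof.
apply: L0ext_eq => /=.
  apply/val_inj => /=; rewrite (lieNC Y X) (lieNC (Y 1) (X 1)) linearN opprK.
  by rewrite addrACA addNr subrr addr0 scaler0 oppr0.
by rewrite eta_tilde_sym scalerA mulrN mulVf ?pnatr_eq0// scaleN1r.
Qed.

End Adjustment.

(** The remaining fields are proofs of propositions, hence irrelevant. *)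
Lemma sym2_ad_eq (R : realType) (f : lieAlgType R) (a : lmodType R)
    (B C : sym2_ad f a) : (forall x y, B x y = C x y) -> B = C.
Proof.
case: B C => [B p1 p2 p3 p4] [C q1 q2 q3 q4] /= BC.
have {}BC : B = C by apply/funext => x; exact/funext.
rewrite BC in p1 p2 p3 p4 *.
by congr Sym2Ad; exact: Prop_irrelevance.
Qed.

(** Every element of q is some p(X) and i is injective, so the symmetric part of
    eta determines the values of the form. *)
Lemma KLadj_unique (R : realType) (h g : lieAlgType R)
    (G : lie_crossed_module h g) (q k : lieAlgType R)
    (H : cm_homotopy G q k) (eta : g -> g -> h) (B : sym2_ad q k) :
  (forall X Y, 2^-1 *: (eta X Y + eta Y X) =
    - cm_i H (B (cm_p H X) (cm_p H Y))) ->
  is_KLadj H eta B.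
Proof.
move=> etaB; split=> // C etaC; apply: sym2_ad_eq => x y.
have [[X <-] [Y <-]] := (cm_p_surj H x, cm_p_surj H y).
by apply/(cm_i_inj (c := H))/oppr_inj; rewrite -etaB etaC.
Qed.

Theorem theorem6p1 (R : realType) (f a : finLieAlgType R)
    (a_abelian : lie_abelian a) (B : sym2_ad f a)
    (s : cm_section (GB_homotopy B a_abelian)) :
  [/\ is_infinitesimal_adjustment (GB B) (eta_Bs s),
      is_adapted s (eta_Bs s) &
      is_KLadj (GB_homotopy B a_abelian) (eta_Bs s) B].
Proof.
split; [exact: eta_Bs_adjustment|exact: eta_Bs_adapted|].
by apply: KLadj_unique => X Y; exact: eta_Bs_symmetric_part.
Qed.
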